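(* Consider the linear benchmark serial supply chain with tiers $k=1,\dots,n$, order-up-to multipliers $\theta_k$, smoothing parameters $\lambda_k$, demand process $D=\{D_t\}$ and decision shocks $\epsilon=\{\epsilon_{k,t}\}$ described in the context. Suppose there are constants $\theta>0$ and $\lambda\in(0,1]$ with $\theta_k\ge\theta$ and $\lambda_k\in[\lambda,1]$ for every $k$. Suppose $\mathbb E[D_t]=0$ for all $t$, the $D_t$ are independent across time, and $\operatorname{Var}(D_t)\ge\sigma_D^2>0$ for all $t$. Suppose the shocks satisfy $\mathbb E[\epsilon_{k,t}]=0$, are independent across tiers and time, are independent of the demand process, and satisfy $\operatorname{Var}(\epsilon_{k,t})\ge\sigma_k^2>0$ for all $k,t$. Then the decision-driven component of the order variance satisfies, for every $k\in\{1,\dots,n\}$ and every $t$, $$V^\epsilon_k:=\mathbb E_D\big[\operatorname{Var}_\epsilon(q_{k,t}\mid D)\big]\ \ge\ 2\sum_{j=1}^k\sigma_j^2\,\Gamma^{k-j},\qquad \Gamma=1+2\theta\lambda+\frac{2\theta^2\lambda^2}{2-\lambda}>1.$$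
   Context: Time is indexed by $t\in\mathbb Z$; $\mathcal L$ is the lag operator, $\mathcal L x_t=x_{t-1}$. Tier $0$ is external customer demand, $q_{0,t}=D_t$. In the linear benchmark, tier $k$ ($1\le k\le n$) has real processes $q_{k,t}$ (order), $IP_{k,t}$ (inventory position), $\hat q_{k,t}$ (forecast) and decision shock $\epsilon_{k,t}$, with $$q_{k,t}=\theta_k\hat q_{k,t}+\epsilon_{k,t}-IP_{k,t},\quad IP_{k,t+1}=IP_{k,t}+q_{k,t}-q_{k-1,t},\quad \hat q_{k,t}=\lambda_k q_{k-1,t-1}+(1-\lambda_k)\hat q_{k,t-1}.$$ These yield the transfer representation $q_k=H_k(\mathcal L)q_{k-1}+G(\mathcal L)\epsilon_k$, where $$H_k(\mathcal L)=\frac{(1+\theta_k\lambda_k)\mathcal L-(\theta_k\lambda_k+1-\lambda_k)\mathcal L^2}{1-(1-\lambda_k)\mathcal L},\qquad G(\mathcal L)=1-\mathcal L.$$ Orders are understood as the stationary-regime (infinite past) solution: rational functions of $\mathcal L$ are expanded as power series $\sum_{j\ge0}a_j\mathcal L^j$, acting by $x_t\mapsto\sum_{j\ge 0}a_jx_{t-j}$, and $$q_{k,t}=\Big[\Big(\prod_{r=1}^kH_r(\mathcal L)\Big)D\Big]_t+\sum_{j=1}^k\Big[\Big(\prod_{r=j+1}^kH_r(\mathcal L)\Big)G(\mathcal L)\epsilon_j\Big]_t$$ (empty product equals the identity). All random variables have finite second moments and these series are assumed to converge in mean square. $\operatorname{Var}_\epsilon(\,\cdot\mid D)$ denotes the conditional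 variance given the whole demand path (randomness of the shocks only), and $\mathbb E_D$ is the expectation over the demand path. *)

(* Defs.v *)
From HB Require Import structures.
From mathcomp Require Import all_boot all_order all_algebra.
From mathcomp Require Import all_classical all_reals all_analysis.
From mathcomp Require Import measurable_realfun.
Set Implicit Arguments.
Unset Strict Implicit.
Unset Printing Implicit Defensive.
Import Order.TTheory GRing.Theory Num.Theory.
Import numFieldNormedType.Exports.
Local Open Scope classical_set_scope.
Local Open Scope ring_scope.

(* A rational function of the lag operator is a pair of polynomials
   num / den in the indeterminate 'X with den`_0 != 0.  Its power-series
   expansion is obtained by long division: the first [n] coefficients are
   [expansion_seq num den n]. *)
Fixpoint expansion_seq (F : fieldType) (num den : {poly F}) (n : nat) : seq F :=
  if n is m.+1 then
    let s := expansion_seq num den m in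
    rcons s ((num`_m - \sum_(i < m) s`_i * den`_(m - i)) / den`_0)
  else [::].

Definition expansion (F : fieldType) (num den : {poly F}) (n : nat) : F :=
  (expansion_seq num den n.+1)`_n.

Lemma size_expansion_seq (F : fieldType) (num den : {poly F}) n :
  size (expansion_seq num den n) = n.
Proof. by elim: n => //= n IHn; rewrite size_rcons IHn. Qed.

Lemma nth_expansion_seq (F : fieldType) (num den : {poly F}) n i :
  (i < n)%N -> (expansion_seq num den n)`_i = expansion num den i.
Proof.
elim: n => // n IHn; rewrite ltnS leq_eqVlt => /predU1P[->//|lt_in].
by rewrite [LHS]nth_rcons size_expansion_seq lt_in IHn.
Qed.

Lemma expansionP (F : fieldType) (num den : {poly F}) : den`_0 != 0 ->
  forall n, \sum_(i < n.+1) expansion num den i * den`_(n - i) = num`_n.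
Proof.
move=> den0 n.
rewrite [RHS](_ : _ = \sum_(i < n) expansion num den i * den`_(n - i)
    + (num`_n - \sum_(i < n) expansion num den i * den`_(n - i))); last first.
  by rewrite addrC subrK.
rewrite big_ord_recr subnn; congr (_ + _).
rewrite [expansion num den _]nth_rcons size_expansion_seq ltnn eqxx divfK //.
congr (_ - _); apply: eq_bigr => i _.
by rewrite nth_expansion_seq.
Qed.

Section TransferFunctions.
Context (R : realType) (theta lambda : nat -> R).

Definition H_num (k : nat) : {poly R} :=
  (1 + theta k * lambda k) *: 'X
  - (theta k * lambda k + 1 - lambda k) *: 'X^2.

Definition H_den (k : nat) : {poly R} := 1 - (1 - lambda k) *: 'X.

Definition G_poly : {poly R} := 1 - 'X.

(* coefficients of  \prod_(j < r <= k) H_r *)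
Definition H_coef (j k : nat) : nat -> R :=
  expansion (\prod_(j.+1 <= r < k.+1) H_num r) (\prod_(j.+1 <= r < k.+1) H_den r).

(* coefficients of  (\prod_(j < r <= k) H_r) * G *)
Definition HG_coef (j k : nat) : nat -> R :=
  expansion ((\prod_(j.+1 <= r < k.+1) H_num r) * G_poly)
            (\prod_(j.+1 <= r < k.+1) H_den r).

End TransferFunctions.

Section Probability.
Context d (T : measurableType d) (R : realType) (P : probability T R).

Definition ms_cvg (S : nat -> T -> R) (X : T -> R) : Prop :=
  X \in Lfun P 2%:E /\
  'E_P[(fun w => (S N w - X w) ^+ 2)%R]%E @[N --> \oo] --> 0%E.

(* the series  \sum_(i >= 0) a_i x_(t - i)  converges in mean square to y *)
Definition filter_at (a : nat -> R) (x : int -> T -> R) (t : int)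
    (y : T -> R) : Prop :=
  ms_cvg (fun N w => \sum_(i < N) a i * x (t - i%:Z) w) y.

Definition mutually_independent (I : choiceType) (J : set I)
    (X : I -> T -> R) : Prop :=
  forall (s : seq I) (B : I -> set R), uniq s -> [set` s] `<=` J ->
    (forall i, measurable (B i)) ->
    P (\bigcap_(i in [set` s]) (X i @^-1` B i)) =
    (\prod_(i <- s) P (X i @^-1` B i))%E.

Definition sigma_process (I : Type) (J : set I) (X : I -> T -> R)
    : set (set T) :=
  <<s \bigcup_(i in J) preimage_set_system setT (X i) measurable >>.

Definition independent_sigma (F G : set (set T)) : Prop :=
  forall A B, F A -> G B -> P (A `&` B) = (P A * P B)%E.

Definition is_cond_exp (G : set (set T)) (X Y : T -> R) : Prop :=
  [/\ forall B, measurable B -> G (Y @^-1` B),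
      P.-integrable setT (EFin \o Y)
    & forall A, G A ->
        (\int[P]_(w in A) (Y w)%:E = \int[P]_(w in A) (X w)%:E)%E].

(* an arbitrary version; one exists by [cond_expP] below *)
Definition cond_exp (G : set (set T)) (X : T -> R) : T -> R :=
  xget (cst 0) [set Y | is_cond_exp G X Y].

Definition cond_var (G : set (set T)) (X : T -> R) : T -> R :=
  cond_exp G (fun w => (X w - cond_exp G X w) ^+ 2).

Lemma sigma_process_measurable (I : Type) (J : set I) (X : I -> T -> R) :
  (forall i, J i -> measurable_fun setT (X i)) ->
  sigma_process J X `<=` measurable.
Proof.
move=> mX; apply: smallest_sub; first exact: sigma_algebra_measurable.
by move=> A [i Ji [B mB <-]]; exact: mX.
Qed.

Lemma cond_expP (F : set (set T)) (X : T -> R) :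
  <<s F >> `<=` measurable -> P.-integrable setT (EFin \o X) ->
  is_cond_exp <<s F >> X (cond_exp <<s F >> X).
Proof.
move=> FT intX; have /integrableP[mX _] := intX.
suff [Y HY] : exists Y, is_cond_exp <<s F >> X Y.
  by rewrite /cond_exp; case: xgetP => [Z _ //|/(_ Y)].
have null0 (A : set T) : measurable A -> P A = 0%E ->
    (\int[P]_(w in A) (X w)%:E)%E = 0%E.
  by move=> mA PA; apply: null_set_integral => //; exact: measurable_funS mX.
have mphi : measurable_fun setT (idfun : T -> g_sigma_algebraType F).
  by move=> _ A mA; rewrite setTI; exact: FT.
pose phi : {RV P >-> g_sigma_algebraType F} := HB.pack (idfun : T -> g_sigma_algebraType F)
  (isMeasurableFun.Build _ _ _ _ _ mphi).
pose mu := distribution P phi.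
pose nu0 : {charge set T -> \bar R} := induced_charge intX.
pose push : {charge set g_sigma_algebraType F -> \bar R} := pushforward nu0 phi.
pose nu := push mphi.
have nuX A : nu A = (\int[P]_(w in A) (X w)%:E)%E by [].
have nu_mu : nu `<< mu.
  apply/null_content_dominatesP => A mA muA.
  exact: (null0 A (FT A mA) muA).
have [f [fin_f int_f nuE]] : exists f : g_sigma_algebraType F -> \bar R,
    [/\ forall x, f x \is a fin_num, mu.-integrable setT f
      & forall A, measurable A -> nu A = (\int[mu]_(x in A) f x)%E].
  exists (Radon_Nikodym nu mu); split.
  - by move=> x; exact: Radon_Nikodym_fin_num.
  - exact: Radon_Nikodym_integrable.
  - by move=> A mA; exact: Radon_Nikodym_integral.
have fE : EFin \o (fine \o f) = f by apply/funext => x /=; rewrite fineK.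
have /integrableP[mf f_fin] := int_f.
have intfT : P.-integrable setT (f \o phi).
  apply/integrableP; split; first exact: (measurableT_comp mf mphi).
  move: f_fin; apply: le_lt_trans.
  by rewrite ge0_integral_distribution//; exact: measurableT_comp.
exists (fine \o f); split => [B mB||A FA].
- have mfine : measurable_fun [set: g_sigma_algebraType F] (fine \o f) by exact: measurableT_comp.
  by have := mfine measurableT B mB; rewrite setTI.
- by rewrite fE.
- under eq_integral do rewrite [_%:E](congr1 (fun g => g _) fE).
  rewrite -nuX (nuE A FA) [RHS]integral_pushforward//.
  by apply: integrableS intfT => //; exact: FT.
Qed.

(* E_D [Var_eps (X | D)]: the conditioning is on the sigma-algebra generated by
   the whole path D, and the outer expectation is that of a D-measurable
   variable. *)
Definition decision_variance (D : int -> T -> R) (X : T -> R) : \bar R :=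
  'E_P[cond_var (sigma_process setT D) X]%E.

Definition linear_benchmark (n : nat) (theta lambda : nat -> R)
    (D : int -> T -> R) (q IP qhat eps : nat -> int -> T -> R) : Prop :=
  (forall t, q 0%N t = D t) /\
  forall k t, (1 <= k <= n)%N ->
  [/\ {ae P, forall w, q k t w = theta k * qhat k t w + eps k t w - IP k t w},
      {ae P, forall w, IP k (t + 1) w = IP k t w + q k t w - q k.-1 t w}
    & {ae P, forall w, qhat k t w =
         lambda k * q k.-1 (t - 1) w + (1 - lambda k) * qhat k (t - 1) w}].

(* the infinite-past solution; every series has its own mean-square limit *)
Definition stationary_orders (n : nat) (theta lambda : nat -> R)
    (D : int -> T -> R) (q eps : nat -> int -> T -> R) : Prop :=
  forall k t, (1 <= k <= n)%N ->
  exists (A : T -> R) (B : nat -> T -> R),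
  [/\ filter_at (H_coef theta lambda 0 k) D t A,
      forall j, (1 <= j <= k)%N ->
        filter_at (HG_coef theta lambda j k) (eps j) t (B j)
    & {ae P, forall w, q k t w = A w + \sum_(1 <= j < k.+1) B j w}].

End Probability.

Definition Gamma (R : realType) (theta lambda : R) : R :=
  1 + 2 * theta * lambda + 2 * theta ^+ 2 * lambda ^+ 2 / (2 - lambda).

(* Main.v *)
Require Import Defs.
From HB Require Import structures.
From mathcomp Require Import all_boot all_order all_algebra.
From mathcomp Require Import all_classical all_reals all_analysis.
From mathcomp Require Import measurable_realfun.
From mathcomp Require Import ring lra.
Set Implicit Arguments.
Unset Strict Implicit.
Unset Printing Implicit Defensive.
Import Order.TTheory GRing.Theory Num.Theory.
Import numFieldNormedType.Exports.
Local Open Scope classical_set_scope.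
Local Open Scope ring_scope.

(** Given the demand path, [q_k] fluctuates only through the shock series
[W = sum_j (H_(j+1) ... H_k G) eps_j], whose mean square is at least
[sum_j sigma_j^2 ||H_(j+1) ... H_k G||^2], with [l^2] norms of coefficients.

With [s = 1 - lambda_r], [c = theta_r lambda_r], [z = exp (i w)] and
[v = cos w], one has [|H_r|^2 = 1 + (c (1 + s) + c^2) |1 - z|^2 / |1 - s z|^2].
Both this and [|G|^2 = 2 - 2 v] decrease in [v], so the squared norm of a
product is at least the product of the squared norms (Chebyshev), and
[||H_r||^2 = 1 + 2 c + 2 c^2 / (1 + s) >= Gamma], [||G||^2 = 2].

Fourier analysis is avoided as follows.  The gap [||H b||^2 - ||H||^2 ||b||^2]
is a nonnegative multiple of [<y, (s - v) y>], where [y = b / (1 - s L)] and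
[v] now stands for the symmetrised lag [(L + L^-1) / 2].  Each factor
satisfies [|H|^2 = m + (r - v) |N|^2] with [m >= 0], so that
[<H y, (r - v) H y> = m <y, (r - v) y> + ||(r - v) N y||^2]; nonnegativity is
thus preserved by every factor, and it starts from
[<y, (r - v) y> = 0] at [y = 1 / (1 - r L)]. *)

(** * Square-summable sequences and the lag operator *)

Section PowerSeries.
Context (F : fieldType).
Implicit Types (a b x : nat -> F) (p q : {poly F}).

(** Power series in the lag are one-sided sequences of coefficients, so the entry shifted in at
    index 0 is 0. *)
Definition lag a : nat -> F := fun i => if i is m.+1 then a m else 0.

(** The series [a / (1 - s L)], given by its autoregressive recursion. *)
Fixpoint ar1 (s : F) a (i : nat) : F :=
  if i is m.+1 then s * ar1 s a m + a m.+1 else a 0%N.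

Definition cauchy_conv p a (n : nat) : F := \sum_(i < n.+1) a i * p`_(n - i).

Lemma ar_eq s a i : ar1 s a i - s * lag (ar1 s a) i = a i.
Proof. by case: i => [|i] /=; rewrite ?mulr0 ?subr0// addrAC subrr add0r. Qed.

Lemma ar_unique s a x : (forall i, x i - s * lag x i = a i) -> x = ar1 s a.
Proof.
move=> xa; apply/funext; elim=> [|i IHi] /=.
  by rewrite -xa mulr0 subr0.
by rewrite -IHi -xa /= addrC subrK.
Qed.

Lemma cauchy_conv_lag p a n : cauchy_conv p (lag a) n = lag (cauchy_conv p a) n.
Proof.
rewrite /cauchy_conv big_ord_recl mul0r add0r.
by case: n => [|n] /=; rewrite ?big_ord0//; apply: eq_bigr => i _.
Qed.

Lemma cauchy_conv_mulX p a n :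
  cauchy_conv (p * 'X) a n = lag (cauchy_conv p a) n.
Proof.
rewrite /cauchy_conv big_ord_recr /= subnn coefMX eqxx mulr0 addr0.
case: n => [|n] /=; first by rewrite big_ord0.
apply: eq_bigr => i _; rewrite coefMX.
by have := ltn_ord i; rewrite ltnS => ilen; rewrite subSn.
Qed.

Lemma cauchy_convD p q a n :
  cauchy_conv (p + q) a n = cauchy_conv p a n + cauchy_conv q a n.
Proof.
by rewrite -big_split; apply: eq_bigr => i _; rewrite coefD mulrDr.
Qed.

Lemma cauchy_convZ c p a n : cauchy_conv (c *: p) a n = c * cauchy_conv p a n.
Proof. by rewrite mulr_sumr; apply: eq_bigr => i _; rewrite coefZ mulrCA. Qed.

Lemma cauchy_convN p a n : cauchy_conv (- p) a n = - cauchy_conv p a n.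
Proof. by rewrite -scaleN1r cauchy_convZ mulN1r. Qed.

Lemma cauchy_conv_lin p a b c e n :
  cauchy_conv p (fun i => c * a i + e * b i) n =
  c * cauchy_conv p a n + e * cauchy_conv p b n.
Proof.
rewrite !mulr_sumr -big_split; apply: eq_bigr => i _ /=.
by rewrite mulrDl !mulrA.
Qed.

Lemma cauchy_conv_inj p a b : p`_0 != 0 ->
  cauchy_conv p a =1 cauchy_conv p b -> a = b.
Proof.
move=> p0 ab; apply/funext => n; elim/ltn_ind: n => n IH.
have := ab n; rewrite /cauchy_conv !big_ord_recr /= subnn.
rewrite (eq_bigr (fun i : 'I_n => b i * p`_(n - i))); last first.
  by move=> i _; rewrite IH.
by move/addrI/(mulIf p0).
Qed.

(** Long division is thereby characterised by a product identity; from here on the expansions are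
    handled without their recursion. *)
Lemma expansion_conv (num den : {poly F}) a : den`_0 != 0 ->
  (forall n, cauchy_conv den a n = num`_n) -> expansion num den = a.
Proof.
by move=> d0 H; apply: (cauchy_conv_inj d0) => n;
  rewrite H -(expansionP num d0).
Qed.

(* the transfer function [((1 + c) L - (c + s) L^2) / (1 - s L)] *)
Definition tier_filter (s c : F) a : nat -> F :=
  fun i => (1 + c) * lag (ar1 s a) i - (c + s) * lag (lag (ar1 s a)) i.

(** The factor [1 - s *: 'X] cancels the denominator of the tier and leaves its numerator; [p]
    stands for the denominators of the other tiers. Everything is expressed in [x = a / (1 - s L)],
    where [a = x - s L x]. *)
Lemma cauchy_conv_tier p s c a :
  cauchy_conv (p * (1 - s *: 'X)) (tier_filter s c a) =1
  cauchy_conv (p * ((1 + c) *: 'X - (c + s) *: 'X^2)) a.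
Proof.
move=> n; set x := ar1 s a.
have -> : p * ((1 + c) *: 'X - (c + s) *: 'X^2) =
    (1 + c) *: (p * 'X) - (c + s) *: (p * 'X * 'X) :> {poly F}.
  by rewrite mulrBr -!scalerAr expr2 mulrA.
have pa m : cauchy_conv p a m = cauchy_conv p x m - s * lag (cauchy_conv p x) m.
  rewrite -cauchy_conv_lag (_ : a = fun i => 1 * x i + (- s) * lag x i).
    by rewrite cauchy_conv_lin mul1r mulNr.
  by apply/funext => i; rewrite mul1r mulNr ar_eq.
have px m : cauchy_conv p (tier_filter s c a) m =
    (1 + c) * lag (cauchy_conv p x) m - (c + s) * lag (lag (cauchy_conv p x)) m.
  rewrite /tier_filter -/x (_ : (fun i => _) =
     fun i => (1 + c) * lag x i + (- (c + s)) * lag (lag x) i).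
    rewrite cauchy_conv_lin mulNr cauchy_conv_lag cauchy_conv_lag.
    congr (_ - _ * _).
    by case: m => //= m; rewrite cauchy_conv_lag.
  by apply/funext => i; rewrite mulNr.
rewrite mulrBr mulr1 -scalerAr cauchy_convD cauchy_convN cauchy_convZ.
rewrite cauchy_conv_mulX.
rewrite cauchy_convD cauchy_convN !cauchy_convZ !cauchy_conv_mulX px.
have s2 : lag (cauchy_conv (p * 'X) a) n = lag (lag (cauchy_conv p a)) n.
  by case: n => //= n; rewrite cauchy_conv_mulX.
rewrite s2; case: n s2 => [|[|n]] _ /=; rewrite ?px ?pa /=; ring.
Qed.

Definition backward_diff a : nat -> F := fun i => a i - lag a i.

(** Filters commute, being products of power series. With [ar_backward_diff], this carries a
    condition on [b / (1 - r L)] through a tier. *)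
Lemma ar_tier r s c a : ar1 r (tier_filter s c a) = tier_filter s c (ar1 r a).
Proof.
apply/esym/ar_unique => i; rewrite /tier_filter.
set y := ar1 s (ar1 r a).
have -> : ar1 s a = fun i => y i - r * lag y i.
  apply/esym/ar_unique => m; rewrite /= -(ar_eq r a m).
  rewrite -(ar_eq s (ar1 r a) m) -/y.
  case: m => [|m] /=; first by ring.
  by rewrite -(ar_eq s (ar1 r a) m) -/y; ring.
by case: i => [|[|i]] /=; ring.
Qed.

Lemma ar_backward_diff r a : ar1 r (backward_diff a) = backward_diff (ar1 r a).
Proof.
apply/esym/ar_unique => i; rewrite /backward_diff -(ar_eq r a i).
case: i => [|i] /=; first by ring.
by rewrite -[a i](ar_eq r a i); ring.
Qed.

End PowerSeries.

(** * Inner products and lag autocorrelations *)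

Section SquareSummable.
Context (R : realType).
Implicit Types (a b x y : nat -> R) (s c r : R).

Definition sq_summable a := exists M : R, forall N, \sum_(i < N) a i ^+ 2 <= M.

(** [limn] is total; the value is a genuine limit on square-summable sequences, by [cvg_l2dot]. *)
Definition l2dot a b : R := limn (fun N => \sum_(i < N) a i * b i).

Lemma sq_summableD a b :
  sq_summable a -> sq_summable b -> sq_summable (fun i => a i + b i).
Proof.
move=> [A hA] [B hB]; exists (2 * A + 2 * B) => N.
apply: (@le_trans _ _ (\sum_(i < N) (2 * a i ^+ 2 + 2 * b i ^+ 2))).
  by apply: ler_sum => i _; have := sqr_ge0 (a i - b i); nra.
rewrite big_split/= -!mulr_sumr; apply: lerD; rewrite ler_pM2l//.
  exact: hA.
exact: hB.
Qed.

Lemma sq_summableZ c a : sq_summable a -> sq_summable (fun i => c * a i).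
Proof.
move=> [A hA]; exists (c ^+ 2 * A) => N.
under eq_bigr do rewrite exprMn.
by rewrite -mulr_sumr ler_wpM2l// sqr_ge0.
Qed.

Lemma sq_summable_lag a : sq_summable a -> sq_summable (lag a).
Proof.
move=> [A hA]; exists A => -[|N].
  by have := hA 0%N; rewrite !big_ord0.
by rewrite big_ord_recl /= expr0n add0r; exact: hA.
Qed.

(* convexity: [(s x + b)^2 <= s x^2 + b^2 / (1 - s)] *)
Lemma sq_summable_ar s a : 0 <= s < 1 -> sq_summable a -> sq_summable (ar1 s a).
Proof.
move=> /andP[s0 s1] [A hA]; exists (A / (1 - s) ^+ 2) => N.
have s1' : 0 < 1 - s by rewrite subr_gt0.
have step i : ar1 s a i ^+ 2 <= s * lag (ar1 s a) i ^+ 2 + a i ^+ 2 / (1 - s).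
  rewrite -(ar_eq s a i); set u := ar1 s a i; set v := lag _ i.
  rewrite -subr_ge0.
  have -> : s * v ^+ 2 + (u - s * v) ^+ 2 / (1 - s) - u ^+ 2 =
     s * (u - v) ^+ 2 / (1 - s) by field; rewrite gt_eqF.
  by apply: divr_ge0; [apply: mulr_ge0 => //; exact: sqr_ge0|exact: ltW].
have sumS : \sum_(i < N) lag (ar1 s a) i ^+ 2 <= \sum_(i < N) ar1 s a i ^+ 2.
  case: N => [|N]; first by rewrite !big_ord0.
  rewrite big_ord_recl [leRHS]big_ord_recr /= expr0n add0r lerDl sqr_ge0//.
(* Summing the convexity bound gives [S <= s S + A / (1 - s)] for the finite partial sum [S], hence
   [S <= A / (1 - s)^2]. *)
have : \sum_(i < N) ar1 s a i ^+ 2 <=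
    s * \sum_(i < N) ar1 s a i ^+ 2 + A / (1 - s).
  apply: (@le_trans _ _ (\sum_(i < N)
      (s * lag (ar1 s a) i ^+ 2 + a i ^+ 2 / (1 - s)))).
    by apply: ler_sum => i _.
  rewrite big_split /= -mulr_sumr -mulr_suml; apply: lerD.
    exact: ler_wpM2l.
  by rewrite ler_pM2r ?invr_gt0; first exact: hA.
rewrite -lerBlDl -[X in X - _]mul1r -mulrBl => h.
by rewrite expr2 invfM mulrA ler_pdivlMr// mulrC.
Qed.

Lemma cvg_sq a : sq_summable a -> cvgn (fun N => \sum_(i < N) a i * a i).
Proof.
move=> [A hA]; apply: nondecreasing_is_cvgn.
  apply/nondecreasing_seqP => N; rewrite big_ord_recr /= lerDl.
  by rewrite -expr2 sqr_ge0.
by exists A => _ [N _ <-].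
Qed.

Lemma cvg_l2dot a b : sq_summable a -> sq_summable b ->
  (fun N => \sum_(i < N) a i * b i) @ \oo --> l2dot a b.
Proof.
move=> la lb.
(* Polarisation reduces convergence to sums of squares, which are monotone and bounded. *)
have h : (fun N => \sum_(i < N) a i * b i) =
   (fun N => 2^-1 * (\sum_(i < N) (a i + b i) * (a i + b i) -
              \sum_(i < N) a i * a i - \sum_(i < N) b i * b i)).
  apply/funext => N; rewrite -!sumrB mulr_sumr; apply: eq_bigr => i _.
  by field.
suff : cvgn (fun N => \sum_(i < N) a i * b i) by [].
rewrite h; apply: is_cvgMr; apply: is_cvgB; first apply: is_cvgB.
- exact: (cvg_sq (sq_summableD la lb)).
- exact: cvg_sq.
- exact: cvg_sq.
Qed.

Lemma l2dot_lim a b l :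
  (fun N => \sum_(i < N) a i * b i) @ \oo --> l -> l2dot a b = l.
Proof. by move=> h; apply: cvg_lim. Qed.

Lemma l2dotC a b : l2dot a b = l2dot b a.
Proof.
by rewrite /l2dot; congr (limn _); apply/funext => N; apply: eq_bigr => i _;
  rewrite mulrC.
Qed.

Lemma l2dotDl a b x : sq_summable a -> sq_summable b -> sq_summable x ->
  l2dot (fun i => a i + b i) x = l2dot a x + l2dot b x.
Proof.
move=> la lb lx; apply: l2dot_lim.
under eq_fun => N do under eq_bigr do rewrite mulrDl.
under eq_fun => N do rewrite big_split.
by apply: cvgD; exact: cvg_l2dot.
Qed.

Lemma l2dotZl c a x : sq_summable a -> sq_summable x ->
  l2dot (fun i => c * a i) x = c * l2dot a x.
Proof.
move=> la lx; apply: l2dot_lim.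
under eq_fun => N do under eq_bigr do rewrite -mulrA.
under eq_fun => N do rewrite -mulr_sumr.
by apply: cvgMr; exact: cvg_l2dot.
Qed.

Lemma l2dot_lag a b : sq_summable a -> sq_summable b ->
  l2dot (lag a) (lag b) = l2dot a b.
Proof.
move=> la lb; apply: l2dot_lim; rewrite -cvg_shiftS /=.
under eq_fun => N do rewrite big_ord_recl /= mul0r add0r.
exact: cvg_l2dot.
Qed.

Lemma l2dot_ge0 a : sq_summable a -> 0 <= l2dot a a.
Proof.
move=> la; apply: limr_ge; first exact: cvg_sq.
by near=> N; apply: sumr_ge0 => i _; rewrite -expr2 sqr_ge0.
Unshelve. all: by end_near. Qed.

(** Every sequence compared below is such a combination of one base sequence, possibly after a
    common delay. By [l2dot_lag3] all quadratic forms then become linear in the autocorrelations of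
    the base sequence at lags 0, 1 and 2. *)
Definition lag3 (u v w : R) x : nat -> R :=
  fun i => u * x i + v * lag x i + w * lag (lag x) i.

Lemma sq_summable_lag3 u v w x : sq_summable x -> sq_summable (lag3 u v w x).
Proof.
move=> lx; have lx1 := sq_summable_lag lx; have lx2 := sq_summable_lag lx1.
by do 2?apply: sq_summableD; apply: sq_summableZ.
Qed.

Lemma l2dot_lag3 x u v w u' v' w' : sq_summable x ->
  l2dot (lag3 u v w x) (lag3 u' v' w' x) =
  (u * u' + v * v' + w * w') * l2dot x x +
  (u * v' + v * u' + v * w' + w * v') * l2dot x (lag x) +
  (u * w' + w * u') * l2dot x (lag (lag x)).
Proof.
move=> lx; have lx1 := sq_summable_lag lx; have lx2 := sq_summable_lag lx1.
have lin y : sq_summable y -> forall u v w, l2dot (lag3 u v w x) y =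
    u * l2dot x y + v * l2dot (lag x) y + w * l2dot (lag (lag x)) y.
  by move=> ly *; rewrite l2dotDl ?l2dotDl ?l2dotZl//;
    do ?apply: sq_summableD; apply: sq_summableZ.
have l3 : sq_summable (lag3 u' v' w' x) by exact: sq_summable_lag3.
rewrite (lin _ l3) !(l2dotC _ (lag3 _ _ _ _)) !lin//.
rewrite !(l2dotC (lag _) x).
rewrite !(l2dotC (lag (lag x)) (lag x)) !l2dot_lag//.
by ring.
Qed.

(* [<x, (r - v) x>] for the symmetrised lag [v = (L + L^-1) / 2] *)
Definition lag_form r x := r * l2dot x x - l2dot x (lag x).

(* [|| (r - v) x ||^2 >= 0], delayed by one to stay one-sided *)
Lemma sqr_lag_form_ge0 r x : sq_summable x ->
  0 <= r ^+ 2 * l2dot x x - 2 * r * l2dot x (lag x)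
       + (l2dot x x + l2dot x (lag (lag x))) / 2.
Proof.
move=> lx; have := l2dot_ge0 (sq_summable_lag3 (- 2^-1) r (- 2^-1) lx).
rewrite l2dot_lag3//; set p := l2dot _ _; set q := l2dot _ _.
by set t := l2dot _ _; lra.
Qed.

Lemma lag_form_lag3 r x u v : sq_summable x ->
  lag_form r (lag3 u v 0 x) =
  (r * (u ^+ 2 + v ^+ 2) - u * v) * l2dot x x +
  (2 * r * u * v - (u ^+ 2 + v ^+ 2)) * l2dot x (lag x) -
  u * v * l2dot x (lag (lag x)).
Proof.
move=> lx; rewrite /lag_form.
have -> : lag (lag3 u v 0 x) = lag3 0 u v x.
  by apply/funext => -[|[|i]]; rewrite /lag3 /=; ring.
by rewrite !l2dot_lag3//; ring.
Qed.

(** Since [|1 - z|^2 = 2 (1 - r) + 2 (r - v)], the new form is [2 (1 - r)] times the old one plus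
    [2 ||(r - v) x||^2]. *)
Lemma lag_form_diff_ge0 r x : 0 <= r < 1 -> sq_summable x ->
  0 <= lag_form r x -> 0 <= lag_form r (backward_diff x).
Proof.
move=> /andP[r0 r1] lx Jx.
have -> : backward_diff x = lag3 1 (-1) 0 x.
  by apply/funext => i; rewrite /lag3 /backward_diff; ring.
rewrite lag_form_lag3//; have := sqr_lag_form_ge0 r lx.
have : 0 <= (1 - r) * lag_form r x by rewrite mulr_ge0// subr_ge0 ltW.
rewrite /lag_form; set p := l2dot _ _; set q := l2dot _ _.
by set t := l2dot _ _; nra.
Qed.

Lemma lag_form_tier_ge0 r s c x : 0 <= r < 1 -> 0 <= s < 1 -> 0 <= c ->
  sq_summable x ->
  0 <= lag_form r x -> 0 <= lag_form r (tier_filter s c x).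
Proof.
move=> /andP[r0 r1] s01 c0 lx Jx; have /andP[s0 s1] := s01.
set y := ar1 s x; have ly : sq_summable y by exact: sq_summable_ar.
have xE : x = lag3 1 (- s) 0 y.
  by apply/funext => i; rewrite /lag3 -[LHS](ar_eq s x) -/y; ring.
have lt := sq_summable_lag3 (1 + c) (- (c + s)) 0 ly.
(* The transfer function has a factor [L], an isometry; removing it leaves a first-order combination
   of [y]. *)
have tE : tier_filter s c x = lag (lag3 (1 + c) (- (c + s)) 0 y).
  by apply/funext => -[|i]; rewrite /tier_filter /lag3 -/y /=; ring.
rewrite tE {1}/lag_form !l2dot_lag//; last exact: sq_summable_lag.
rewrite -/(lag_form _ _) lag_form_lag3//.
move: Jx; rewrite xE lag_form_lag3//.
have := sqr_lag_form_ge0 r ly.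
set p := l2dot _ _; set q := l2dot _ _; set t := l2dot _ _.
(* On the unit circle, with [v = cos w], [den u = 1 + s^2 - 2 s u] (so that
   [den v = |1 - s z|^2]) and [C = c (1 + s) + c^2], the squared modulus is
   [1 + 2 C (1 - v) / den v = 1 + 2 C (1 - r) / den r
      + (r - v) * 2 C (1 - s)^2 / (den r * den v)]. *)
move=> hS hJ.
set den := 1 + s ^+ 2 - 2 * s * r.
(* Here [den = (1 - s)^2 + 2 s (1 - r)]. *)
have den0 : 0 < den by rewrite /den; nra.
set C := c * (1 + s) + c ^+ 2.
have C0 : 0 <= C by rewrite addr_ge0 ?sqr_ge0// mulr_ge0// addr_ge0.
rewrite [X in 0 <= X](_ : _ = (1 + 2 * C * (1 - r) / den) *
   ((r * (1 ^+ 2 + (- s) ^+ 2) - 1 * - s) * p +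
    (2 * r * 1 * - s - (1 ^+ 2 + (- s) ^+ 2)) * q - 1 * - s * t) +
   2 * C * (1 - s) ^+ 2 / den *
   (r ^+ 2 * p - 2 * r * q + (p + t) / 2)).
  have r1' : 0 <= 1 - r by rewrite subr_ge0 ltW.
  have d0 := ltW den0.
  apply: addr_ge0; apply: mulr_ge0 => //.
    by apply: addr_ge0 => //; apply: divr_ge0 => //; rewrite !mulr_ge0.
  by apply: divr_ge0 => //; apply: mulr_ge0; rewrite ?sqr_ge0// mulr_ge0.
by rewrite /C /den; field; rewrite -/den gt_eqF.
Qed.

(** * High-pass sequences and the gain of one tier *)

Definition impulse : nat -> R := fun i => (i == 0%N)%:R.

Lemma sq_summable_impulse : sq_summable impulse.
Proof.
exists 1 => -[|N]; first by rewrite big_ord0.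
by rewrite big_ord_recl big1 ?addr0 ?expr1n// => i _; rewrite expr0n.
Qed.

Lemma l2dot_impulse a : l2dot impulse a = a 0%N.
Proof.
apply: l2dot_lim; rewrite -cvg_shiftS /=.
under eq_fun => N.
  rewrite big_ord_recl big1 ?addr0 ?mul1r => [|i _]; last by rewrite mul0r.
  over.
exact: cvg_cst.
Qed.

(** The impulse is orthogonal to [L x], whose entry at 0 vanishes. Writing the impulse as
    [x - r L x] turns this into [<x, L x> = r <x, x>]. *)
Lemma lag_form_ar_impulse r : 0 <= r < 1 -> lag_form r (ar1 r impulse) = 0.
Proof.
move=> r01; set x := ar1 r impulse.
have lx : sq_summable x.
  by apply: sq_summable_ar => //; exact: sq_summable_impulse.
have dE : impulse = lag3 1 (- r) 0 x.
  by apply/funext => i; rewrite /lag3 -[LHS](ar_eq r impulse) -/x; ring.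
have sdE : lag impulse = lag3 0 1 (- r) x.
  by rewrite dE; apply/funext => -[|[|i]]; rewrite /lag3 /=; ring.
have x3 : x = lag3 1 0 0 x by apply/funext => i; rewrite /lag3; ring.
have sx3 : lag x = lag3 0 1 0 x by apply/funext => i; rewrite /lag3; ring.
have : l2dot impulse (lag x) = 0 by rewrite l2dot_impulse.
rewrite {1}dE [X in l2dot _ X]sx3 l2dot_lag3// /lag_form.
by set p := l2dot _ _; set q := l2dot _ _; set t := l2dot _ _; lra.
Qed.

(** Under the Poisson kernel of parameter [r], proportional to [1 / |1 - r z|^2], the mean of [v] is
    [r]; the condition says that [|b|^2] and [v] have nonpositive covariance there. All [r] are
    required because the parameter [s] of the next tier is arbitrary. *)
Definition high_pass b :=
  sq_summable b /\ forall r, 0 <= r < 1 -> 0 <= lag_form r (ar1 r b).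

Lemma high_pass_diff_impulse : high_pass (backward_diff impulse).
Proof.
split.
  rewrite (_ : backward_diff impulse =
      fun i => impulse i + (-1) * lag impulse i).
    apply: sq_summableD; first exact: sq_summable_impulse.
    by apply: sq_summableZ; apply: sq_summable_lag; exact: sq_summable_impulse.
  by apply/funext => i; rewrite mulN1r.
move=> r r01; rewrite ar_backward_diff lag_form_diff_ge0 ?lag_form_ar_impulse//.
by apply: sq_summable_ar => //; exact: sq_summable_impulse.
Qed.

Lemma high_pass_tier s c b : 0 <= s < 1 -> 0 <= c ->
  high_pass b -> high_pass (tier_filter s c b).
Proof.
move=> s01 c0 [lb Jb]; split.
  have lx := sq_summable_lag (sq_summable_ar s01 lb).
  rewrite (_ : tier_filter s c b = fun i => (1 + c) * lag (ar1 s b) i +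
     (- (c + s)) * lag (lag (ar1 s b)) i).
    by apply: sq_summableD; apply: sq_summableZ => //; exact: sq_summable_lag.
  by apply/funext => i; rewrite mulNr.
by move=> r r01; rewrite ar_tier; apply: lag_form_tier_ge0 => //;
  [exact: sq_summable_ar|exact: Jb].
Qed.

Lemma l2dot_tier_ge s c b : 0 <= s < 1 -> 0 <= c -> high_pass b ->
  (1 + 2 * c + 2 * c ^+ 2 / (1 + s)) * l2dot b b <=
  l2dot (tier_filter s c b) (tier_filter s c b).
Proof.
move=> s01 c0 [lb Jb]; have /andP[s0 s1] := s01.
set y := ar1 s b; have ly : sq_summable y by exact: sq_summable_ar.
have bE : b = lag3 1 (- s) 0 y.
  by apply/funext => i; rewrite /lag3 -[LHS](ar_eq s b) -/y; ring.
have tE : tier_filter s c b = lag3 0 (1 + c) (- (c + s)) y.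
  by apply/funext => -[|[|i]]; rewrite /tier_filter /lag3 -/y /=; ring.
rewrite tE bE !l2dot_lag3//.
have := Jb _ s01; rewrite -/y /lag_form.
set p := l2dot _ _; set q := l2dot _ _; set t := l2dot _ _ => hJ.
(* The gap is an exact multiple of [<y, (s - v) y>], which is the high-pass condition at [r = s]. *)
rewrite -subr_ge0 [X in 0 <= X](_ : _ =
   2 * (c * (1 + s) + c ^+ 2) * (1 - s) / (1 + s) * (s * p - q)).
  have ? : 0 <= 1 - s by rewrite subr_ge0 ltW.
  have ? : 0 <= 1 + s by rewrite addr_ge0.
  by rewrite !mulr_ge0 ?invr_ge0// addr_ge0 ?sqr_ge0 ?mulr_ge0.
by field; rewrite gt_eqF// ltr_wpDr.
Qed.

Lemma l2dot_backward_diff_impulse :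
  l2dot (backward_diff impulse) (backward_diff impulse) = 2.
Proof.
have ld := sq_summable_impulse.
have -> : backward_diff impulse = lag3 1 (-1) 0 impulse.
  by apply/funext => i; rewrite /lag3/backward_diff; ring.
rewrite l2dot_lag3// !l2dot_impulse /= (_ : impulse 0%N = 1)//.
by ring.
Qed.

(** * Norms of the shock transfer coefficients *)

Section Coefficients.
Context (theta lambda : nat -> R).

Lemma coef0_H_den j k : (\prod_(j.+1 <= r < k.+1) H_den lambda r)`_0 != 0.
Proof.
rewrite -horner_coef0 horner_prod big1 ?oner_neq0// => i _.
by rewrite /H_den !hornerE ?mulr0 ?subr0.
Qed.

Lemma HG_coef_id j : HG_coef theta lambda j j = backward_diff impulse.
Proof.
apply: expansion_conv; first exact: coef0_H_den.
move=> n; rewrite !big_geq// mul1r.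
rewrite /cauchy_conv big_ord_recr /= subnn coefC eqxx mulr1.
rewrite big1 => [|i _].
  by rewrite add0r coefB coefC coefX; case: n => [|[|n]];
   rewrite /backward_diff /impulse /= ?subr0.
by rewrite coefC subn_eq0 leqNgt ltn_ord mulr0.
Qed.

(** By [expansion_conv] both sides may be multiplied by all the denominators: [cauchy_conv_tier]
    cancels that of the last tier, and [expansionP] those of the earlier ones. *)
Lemma HG_coefS j k : (j <= k)%N ->
  HG_coef theta lambda j k.+1 =
  tier_filter (1 - lambda k.+1) (theta k.+1 * lambda k.+1)
    (HG_coef theta lambda j k).
Proof.
move=> jk; apply: expansion_conv; first exact: coef0_H_den.
move=> n; rewrite !(big_nat_recr k.+1)//= /H_den -/(H_den _ _) cauchy_conv_tier.
set c := theta _ * _; set s := 1 - _.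
have -> : (1 + c) *: 'X - (c + s) *: 'X^2 = H_num theta lambda k.+1.
  by rewrite /H_num /s addrA.
set N := \prod_(_ <= i < _) H_num theta lambda i.
set D := \prod_(_ <= i < _) (1 - _ *: 'X).
rewrite -mulrA (mulrC (H_num _ _ _)) mulrA.
have convM m : cauchy_conv D (HG_coef theta lambda j k) m = (N * G_poly R)`_m.
  by rewrite -(expansionP _ (coef0_H_den j k)).
move: (N * _) convM => M convM.
rewrite /H_num !mulrBr -!scalerAr exprS expr1 !mulrA.
rewrite cauchy_convD cauchy_convN !cauchy_convZ coefB !coefZ !cauchy_conv_mulX.
have sE (p : {poly R}) m :
   (forall m, cauchy_conv D (HG_coef theta lambda j k) m = p`_m) ->
   lag (cauchy_conv D (HG_coef theta lambda j k)) m = (p * 'X)`_m.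
  by move=> hp; rewrite coefMX; case: m => //= m; rewrite hp.
congr (_ * _ - _ * _); first exact: sE.
by case: n => [|n] /=; rewrite coefMX//= cauchy_conv_mulX; exact: sE.
Qed.

Lemma high_pass_HG_coef j k :
  (forall i, (j < i <= k)%N -> 0 <= theta i * lambda i /\ 0 < lambda i <= 1) ->
  (j <= k)%N -> high_pass (HG_coef theta lambda j k).
Proof.
move=> h; elim: k h => [|k IHk] h.
  rewrite leqn0 => /eqP ->; rewrite HG_coef_id.
  exact: high_pass_diff_impulse.
rewrite leq_eqVlt ltnS => /predU1P[<-|jk].
  by rewrite HG_coef_id; exact: high_pass_diff_impulse.
have [|c0 /andP[l0 l1]] := h k.+1; first by rewrite ltnS jk leqnn.
rewrite HG_coefS//; apply: high_pass_tier => //; last first.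
  by apply: IHk => // i /andP[ji ik]; apply: h; rewrite ji ltnW.
by rewrite subr_ge0 l1 gtrBl.
Qed.

(** Induction from [||G||^2 = 2]. Each tier gains at least [1 + 2 c + 2 c^2 / (1 + s)] by
    [l2dot_tier_ge]; here [1 + s = 2 - lambda i], and the gain increases with both [c >= th * la]
    and [lambda i >= la]. *)
Lemma l2dot_HG_coef_ge (th la : R) j k : 0 <= th -> 0 < la ->
  (forall i, (j < i <= k)%N -> th <= theta i /\ la <= lambda i <= 1) ->
  (j <= k)%N ->
  2 * Gamma th la ^+ (k - j) <=
    l2dot (HG_coef theta lambda j k) (HG_coef theta lambda j k).
Proof.
move=> th0 la0.
have pos i : th <= theta i /\ la <= lambda i <= 1 ->
    0 <= theta i * lambda i /\ 0 < lambda i <= 1.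
  move=> [ht /andP[hl ->]]; have l0 := lt_le_trans la0 hl.
  by rewrite l0 mulr_ge0// ?(ltW l0)// (le_trans th0).
elim: k => [|k IHk] h.
  rewrite leqn0 => /eqP ->.
  by rewrite HG_coef_id l2dot_backward_diff_impulse mulr1.
rewrite leq_eqVlt ltnS => /predU1P[<-|jk].
  by rewrite HG_coef_id l2dot_backward_diff_impulse subnn mulr1.
have hk i : (j < i <= k)%N -> th <= theta i /\ la <= lambda i <= 1.
  by move=> /andP[ji ik]; apply: h; rewrite ji ltnW.
have h1 : th <= theta k.+1 /\ la <= lambda k.+1 <= 1.
  by apply: h; rewrite ltnS jk leqnn.
have [c0 /andP[l0 l1]] := pos _ h1.
have [ht /andP[hl _]] := h1.
have hp : high_pass (HG_coef theta lambda j k).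
  by apply: high_pass_HG_coef => // i /hk /pos.
rewrite HG_coefS//; apply: le_trans; last first.
  by apply: l2dot_tier_ge => //; rewrite subr_ge0 l1 gtrBl.
rewrite subSn// exprS mulrCA ler_pM//.
- by rewrite /Gamma !addr_ge0 ?mulr_ge0 ?sqr_ge0 ?invr_ge0//; lra.
- rewrite mulr_ge0// exprn_ge0//.
  by rewrite /Gamma !addr_ge0 ?mulr_ge0 ?sqr_ge0 ?invr_ge0//; lra.
- have tl : th * la <= theta k.+1 * lambda k.+1 by rewrite ler_pM// ltW.
  have -> : Gamma th la = 1 + 2 * (th * la) + 2 * ((th * la) ^+ 2 / (2 - la)).
    by rewrite /Gamma exprMn !mulrA.
  rewrite -[X in _ <= _ + X]mulrA; apply: lerD.
    by rewrite lerD2l ler_pM2l.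
  rewrite ler_pM2l//; apply: ler_pM; rewrite ?sqr_ge0 ?invr_ge0//; first by lra.
    by rewrite lerXn2r// nnegrE// mulr_ge0// ltW.
  by rewrite lef_pV2// ?posrE; lra.
- exact: IHk.
Qed.

End Coefficients.
End SquareSummable.

(** * Mean-square limits *)

Section SecondMoments.
Context d (T : measurableType d) (R : realType) (P : probability T R).
Implicit Types (X Y Z : T -> R) (c : R).

Notation L2 := (Lfun P 2%:E).

Definition dot X Y : R := fine 'E_P[X \* Y]%E.

Lemma dotE X Y : X \in L2 -> Y \in L2 -> ('E_P[X \* Y] = (dot X Y)%:E)%E.
Proof. by move=> *; rewrite fineK// expectation_fin_num// Lfun2_mul_Lfun1. Qed.

Lemma Lfun2D X Y : X \in L2 -> Y \in L2 -> X \+ Y \in L2.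
Proof. by move=> lX lY; apply: rpredD; rewrite ?lee1n. Qed.

Lemma Lfun2Z c X : X \in L2 -> (fun w => c * X w) \in L2.
Proof.
move=> lX; rewrite (_ : (fun w => _) = c \o* X).
  exact: Lfun_scale (ler1n R 2) lX.
by apply/funext => w /=; rewrite mulrC.
Qed.

Lemma Lfun2B X Y : X \in L2 -> Y \in L2 -> X \- Y \in L2.
Proof.
move=> lX lY; rewrite (_ : X \- Y = X \+ (fun w => -1 * Y w)).
  by apply: Lfun2D => //; exact: Lfun2Z.
by apply/funext => w /=; rewrite mulN1r.
Qed.

Lemma Lfun2_sum (I : Type) (s : seq I) (X : I -> T -> R) :
  (forall i, X i \in L2) -> (fun w => \sum_(i <- s) X i w) \in L2.
Proof.
move=> lX; elim: s => [|i s IHs].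
  rewrite (_ : (fun w => _) = cst 0) ?Lfun_cst//.
  by apply/funext => w; rewrite big_nil.
rewrite (_ : (fun w => _) = X i \+ (fun w => \sum_(i <- s) X i w)).
  exact: Lfun2D.
by apply/funext => w; rewrite big_cons.
Qed.

Lemma Lfun2_mfun X : X \in L2 -> measurable_fun setT X.
Proof. by move/sub_Lfun_mfun; rewrite inE. Qed.

Lemma Lfun2_L1 X : X \in L2 -> X \in Lfun P 1.
Proof. by apply: Lfun_subset12; rewrite fin_num_measure. Qed.

Lemma Lfun2_integrable X : X \in L2 -> P.-integrable setT (EFin \o X).
Proof. by move=> /Lfun2_L1 /Lfun1_integrable. Qed.

Lemma dotC X Y : dot X Y = dot Y X.
Proof.
by rewrite /dot; congr (fine 'E_P[_]%E); apply/funext => w /=; rewrite mulrC.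
Qed.

Lemma dotDl X Y Z : X \in L2 -> Y \in L2 -> Z \in L2 ->
  dot (X \+ Y) Z = dot X Z + dot Y Z.
Proof.
move=> lX lY lZ; apply: EFin_inj; rewrite EFinD -!dotE ?Lfun2D//.
rewrite -expectationD ?Lfun2_mul_Lfun1//.
by congr ('E_P[_]%E); apply/funext => w /=; rewrite mulrDl.
Qed.

Lemma dotZl c X Y : X \in L2 -> Y \in L2 ->
  dot (fun w => c * X w) Y = c * dot X Y.
Proof.
move=> lX lY; apply: EFin_inj; rewrite EFinM -!dotE ?Lfun2Z//.
rewrite -expectationZl ?Lfun2_mul_Lfun1//.
by congr ('E_P[_]%E); apply/funext => w /=; ring.
Qed.

Lemma dotDr X Y Z : X \in L2 -> Y \in L2 -> Z \in L2 ->
  dot X (Y \+ Z) = dot X Y + dot X Z.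
Proof. by move=> *; rewrite !(dotC X) dotDl. Qed.

Lemma dotZr c X Y : X \in L2 -> Y \in L2 ->
  dot X (fun w => c * Y w) = c * dot X Y.
Proof. by move=> *; rewrite !(dotC X) dotZl. Qed.

Lemma dot_ge0 X : 0 <= dot X X.
Proof. by apply/fine_ge0/expectation_ge0 => w /=; rewrite -expr2 sqr_ge0. Qed.

Lemma dot_sqD X Y : X \in L2 -> Y \in L2 ->
  dot (X \+ Y) (X \+ Y) = dot X X + 2 * dot X Y + dot Y Y.
Proof.
by move=> lX lY; rewrite dotDl ?dotDr ?Lfun2D// (dotC Y X); ring.
Qed.

(** Young's inequality: the difference of the two sides is [||Y - c X||^2 / c]. *)
Lemma dot_sqD_le c X Y : 0 < c -> X \in L2 -> Y \in L2 ->
  dot (X \+ Y) (X \+ Y) <= (1 + c) * dot X X + (1 + c^-1) * dot Y Y.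
Proof.
move=> c0 lX lY.
have := dot_ge0 ((fun w => - c * X w) \+ Y).
rewrite !dot_sqD ?Lfun2Z// dotZl ?Lfun2Z// dotZr// dotZl//.
set p := dot X X; set q := dot X Y; set t := dot Y Y => h.
rewrite -subr_ge0 [X in 0 <= X](_ : _ =
  (- c * (- c * p) + 2 * (- c * q) + t) / c); first by rewrite divr_ge0// ltW.
by field; rewrite gt_eqF.
Qed.

Lemma dot_sum_orth (I : eqType) (s : seq I) (a : I -> R) (X : I -> T -> R) :
  uniq s -> (forall i, X i \in L2) ->
  (forall i j, i \in s -> j \in s -> i != j -> dot (X i) (X j) = 0) ->
  let S := fun w => \sum_(i <- s) a i * X i w in
  dot S S = \sum_(i <- s) a i ^+ 2 * dot (X i) (X i).
Proof.
move=> + lX; have lS s' : (fun w => \sum_(i <- s') a i * X i w) \in L2.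
  by apply: Lfun2_sum => i; exact: Lfun2Z.
elim: s => [_ _|i s IHs /= /andP[is_ us] orth].
  rewrite /= big_nil (_ : (fun w => _) = cst 0); last first.
    by apply/funext => w; rewrite big_nil.
  rewrite /dot (_ : _ \* _ = cst 0) ?expectation_cst//.
  by apply/funext => w /=; rewrite mulr0.
(* The tail is generalised to any [s'] inside [s], so that the inner induction keeps [i] and the
   orthogonality hypothesis fixed. *)
have orthS s' : {subset s' <= s} ->
    dot (X i) (fun w => \sum_(i <- s') a i * X i w) = 0.
  elim: s' => [_|j s' IHs' sub].
    rewrite /dot (_ : _ \* _ = cst 0) ?expectation_cst//.
    by apply/funext => w /=; rewrite big_nil mulr0.
  rewrite (_ : (fun w => _) = (fun w => a j * X j w) \+
      (fun w => \sum_(i <- s') a i * X i w)); last first.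
    by apply/funext => w; rewrite big_cons.
  rewrite dotDr ?Lfun2Z// IHs'; last by move=> l ls; rewrite sub// inE ls orbT.
  have js : j \in s by rewrite sub// mem_head.
  rewrite dotZr// orth ?mulr0 ?addr0 ?inE ?eqxx ?js ?orbT//.
  by apply: contraNneq is_ => ->.
rewrite (_ : (fun w => _) = (fun w => a i * X i w) \+
      (fun w => \sum_(i <- s) a i * X i w)); last first.
  by apply/funext => w; rewrite big_cons.
rewrite dot_sqD ?Lfun2Z// big_cons dotZl ?Lfun2Z// dotZr// dotZl// orthS//.
rewrite IHs//; last first.
  by move=> j l js ls; apply: orth; rewrite inE ?js ?ls orbT.
by ring.
Qed.

Lemma ms_cvgE (S : nat -> T -> R) X : (forall N, S N \in L2) ->
  ms_cvg P S X <->
  X \in L2 /\ (fun N => dot (S N \- X) (S N \- X)) @ \oo --> 0.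
Proof.
move=> lS; split=> -[lX h]; split=> //.
  exact: (fine_cvg h).
have -> : (fun N => 'E_P[(fun w => (S N w - X w) ^+ 2)%R]%E) =
   EFin \o (fun N => dot (S N \- X) (S N \- X)).
  by apply/funext => N /=; rewrite -dotE ?Lfun2B.
by apply: cvg_EFin => /=; first by near=> N.
Unshelve. all: by end_near. Qed.

Lemma ms_cvg_sum (I : eqType) (s : seq I) (S : I -> nat -> T -> R)
    (X : I -> T -> R) :
  (forall i N, S i N \in L2) ->
  (forall i, i \in s -> ms_cvg P (S i) (X i)) ->
  ms_cvg P (fun N w => \sum_(i <- s) S i N w) (fun w => \sum_(i <- s) X i w).
Proof.
move=> lS; have lSs s' N : (fun w => \sum_(i <- s') S i N w) \in L2.
  exact: Lfun2_sum.
elim: s => [_|i s IHs h].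
  apply/ms_cvgE => //; split.
    rewrite (_ : (fun w => _) = cst 0) ?Lfun_cst//.
    by apply/funext => w; rewrite big_nil.
  rewrite (_ : (fun N => _) = cst 0); first exact: cvg_cst.
  apply/funext => N; rewrite /dot (_ : _ \* _ = cst 0) ?expectation_cst//.
  by apply/funext => w /=; rewrite !big_nil subrr mulr0.
have /ms_cvgE[//|lX cX] := h i (mem_head _ _).
have /ms_cvgE[//|lXs cXs] : ms_cvg P (fun N w => \sum_(i <- s) S i N w)
    (fun w => \sum_(i <- s) X i w).
  by apply: IHs => j js; apply: h; rewrite inE js orbT.
apply/ms_cvgE => //; split.
  rewrite (_ : (fun w => _) = X i \+ (fun w => \sum_(i <- s) X i w)).
    exact: Lfun2D.
  by apply/funext => w; rewrite big_cons.
set Ss := fun N w => \sum_(i <- s) S i N w.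
set Xs := fun w => \sum_(i <- s) X i w.
apply: (@squeeze_cvgr _ _ _ _ (cst 0) (fun N =>
  (1 + 1) * dot (S i N \- X i) (S i N \- X i) +
  (1 + 1^-1) * dot (Ss N \- Xs) (Ss N \- Xs))).
- near=> N; rewrite dot_ge0/=.
  rewrite [X in dot X X](_ : _ = (S i N \- X i) \+ (Ss N \- Xs)).
    by rewrite dot_sqD_le ?Lfun2B// /Ss.
  by apply/funext => w /=; rewrite !big_cons /Ss /Xs; ring.
- exact: cvg_cst.
- rewrite -[X in _ --> X](_ : (1 + 1) * 0 + (1 + 1^-1) * 0 = 0).
    by apply: cvgD; apply: cvgMr.
  by rewrite !mulr0 addr0.
Unshelve. all: by end_near. Qed.

(** Split [S N] as [X + (S N - X)] and apply Young's inequality: in the limit [l <= (1 + c) ||X||^2]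
    for every [c > 0]. *)
Lemma ms_cvg_ge (S : nat -> T -> R) X (v : nat -> R) l :
  (forall N, S N \in L2) -> ms_cvg P S X ->
  (forall N, v N <= dot (S N) (S N)) -> v @ \oo --> l ->
  l <= dot X X.
Proof.
move=> lS /(ms_cvgE _ lS)[lX cX] vS vl.
apply/ler_addgt0Pr => e e0.
(* Chosen so that [c ||X||^2 <= e]; the 1 covers [||X|| = 0]. *)
pose c := e / (dot X X + 1).
have X1 : 0 < dot X X + 1 by rewrite ltr_wpDl// dot_ge0.
have c0 : 0 < c by rewrite divr_gt0.
apply: (@le_trans _ _ ((1 + c) * dot X X)); last first.
  rewrite mulrDl mul1r lerD2l /c mulrAC ler_pdivrMr// ler_pM2l//.
  by rewrite lerDl.
have cv : (fun N => (1 + c) * dot X X +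
      (1 + c^-1) * dot (S N \- X) (S N \- X)) @ \oo --> (1 + c) * dot X X.
  rewrite -[X in _ --> X]addr0 -[X in _ --> _ + X](mulr0 (1 + c^-1)).
  by apply: cvgD; [exact: cvg_cst|exact: cvgMr].
apply: (ler_cvg_to vl cv); near=> N; apply: (le_trans (vS N)).
rewrite [X in dot X X](_ : _ = X \+ (S N \- X)).
  by rewrite dot_sqD_le ?Lfun2B.
by apply/funext => w /=; rewrite addrC subrK.
Unshelve. all: by end_near. Qed.

Lemma ms_cvg_orth (S : nat -> T -> R) X Y :
  (forall N, S N \in L2) -> ms_cvg P S X -> Y \in L2 ->
  (forall N, dot Y (S N) = 0) -> dot Y X = 0.
Proof.
move=> lS /(ms_cvgE _ lS)[lX cX] lY YS.
set z := dot Y X; set u := dot Y Y.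
have u0 : 0 <= u := dot_ge0 Y.
have H c : 2 * c * z <= c ^+ 2 * u.
  have cv : (fun N => dot (S N \- X) (S N \- X) + c ^+ 2 * u) @ \oo -->
      c ^+ 2 * u.
    by rewrite -[X in _ --> X]add0r; apply: cvgD => //; exact: cvg_cst.
  apply: (ler_cvg_to (cvg_cst (2 * c * z)) cv); near=> N.
  (* The square of [c Y + (S N - X)] has cross term [- 2 c z], because [Y] is orthogonal to [S N];
     this takes the place of Cauchy-Schwarz. *)
  have := dot_ge0 ((fun w => c * Y w) \+ (S N \- X)).
  rewrite dot_sqD ?Lfun2Z ?Lfun2B// dotZl ?Lfun2Z ?Lfun2B// dotZr//.
  rewrite dotZl ?Lfun2B//.
  have -> : dot Y (S N \- X) = - z.
    rewrite (_ : _ \- _ = S N \+ (fun w => -1 * X w)).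
      by rewrite dotDr ?Lfun2Z// dotZr// YS add0r mulN1r.
    by apply/funext => w /=; rewrite mulN1r.
  by rewrite -/u /=; set x := dot _ _; nra.
(* This [c] makes [c^2 u - 2 c z] a negative multiple of [z^2], which forces [z = 0]. *)
have := H (z / (u + 1)).
have u1 : 0 < u + 1 by rewrite ltr_wpDl.
rewrite -subr_ge0 [X in 0 <= X](_ : _ = - (z ^+ 2 * (u + 2)) / (u + 1) ^+ 2).
  rewrite pmulr_lge0 ?invr_gt0 ?exprn_gt0// oppr_ge0 pmulr_lle0; last first.
    by rewrite ltr_wpDl.
  by move=> z2; apply/eqP; rewrite -sqrf_eq0 eq_le z2 sqr_ge0.
by field; rewrite gt_eqF.
Unshelve. all: by end_near. Qed.

End SecondMoments.

(** * Independence and conditioning *)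

Section Independence.
Context d (T : measurableType d) (R : realType) (P : probability T R).
Implicit Types (X Y Z : T -> R).

Notation L2 := (Lfun P 2%:E).

(* The law of [(X, Y)] is the product of the marginals, so Fubini applies. *)
Lemma independent_expectationM X Y : X \in L2 -> Y \in L2 ->
  (forall B C, measurable B -> measurable C ->
    P (X @^-1` B `&` Y @^-1` C) = P (X @^-1` B) * P (Y @^-1` C))%E ->
  ('E_P[X \* Y] = 'E_P[X] * 'E_P[Y])%E.
Proof.
move=> lX lY ind; have mX := Lfun2_mfun lX; have mY := Lfun2_mfun lY.
have mXY : measurable_fun setT (fun w => (X w, Y w)).
  by apply/measurable_fun_pair.
pose X' : {RV P >-> R} := HB.pack X (isMeasurableFun.Build _ _ _ _ _ mX).
pose Y' : {RV P >-> R} := HB.pack Y (isMeasurableFun.Build _ _ _ _ _ mY).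
pose Z : {RV P >-> (R * R)%type} :=
  HB.pack (fun w => (X w, Y w)) (isMeasurableFun.Build _ _ _ _ _ mXY).
pose mu := distribution P X'; pose nu := distribution P Y'.
have muE : 'E_P[X]%E = (\int[mu]_x x%:E)%E.
  rewrite unlock integral_distribution//.
  exact: Lfun2_integrable.
have nuE : 'E_P[Y]%E = (\int[nu]_x x%:E)%E.
  rewrite unlock integral_distribution//.
  exact: Lfun2_integrable.
have prodE A : measurable A -> (mu \x nu)%E A = distribution P Z A.
  by apply: product_measure_unique => B C mB mC; exact: ind.
pose f (z : R * R) := (z.1 * z.2)%:E.
have mf : measurable_fun setT f.
  by apply/measurable_EFinP; apply: measurable_funM.
have intZ : P.-integrable setT (f \o Z).
  by apply/Lfun1_integrable; exact: Lfun2_mul_Lfun1.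
have intD : (distribution P Z).-integrable setT f.
  exact: integrable_pushforward.
have intf : ((mu \x nu)%E).-integrable setT f.
  apply/integrableP; split => //; have /integrableP[_] := intD.
  apply: le_lt_trans; rewrite (eq_measure_integral (distribution P Z))//.
  by move=> A mA _; first [exact: prodE|exact: (esym (prodE _ mA))].
have -> : 'E_P[X \* Y]%E = (\int[distribution P Z]_z f z)%E.
  by rewrite unlock integral_distribution.
rewrite (eq_measure_integral (mu \x nu)%E); last first.
  by move=> A mA _; first [exact: prodE|exact: (esym (prodE _ mA))].
rewrite -integral12_prod_meas1// /fubini_F /f muE nuE /=.
have intmu : mu.-integrable setT EFin.
  by apply: integrable_pushforward => //; exact: Lfun2_integrable.
have intnu : nu.-integrable setT EFin.
  by apply: integrable_pushforward => //; exact: Lfun2_integrable.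
under eq_integral => x _.
  under eq_integral do rewrite EFinM.
  rewrite integralZl//.
  over.
rewrite -[in RHS](@fineK _ (\int[nu]_x x%:E)%E); last first.
  by rewrite integrable_fin_num.
by rewrite -integralZr// fineK// integrable_fin_num.
Qed.

Lemma mutually_independent_pair (I : choiceType) (J : set I) (X : I -> T -> R)
    i j : mutually_independent P J X -> J i -> J j -> i != j ->
  forall B C, measurable B -> measurable C ->
  (P (X i @^-1` B `&` X j @^-1` C) = P (X i @^-1` B) * P (X j @^-1` C))%E.
Proof.
move=> ind Ji Jj ij B C mB mC.
have := ind [:: i; j] (fun l => if l == i then B else C).
rewrite /= inE ij bigcap_seq !big_cons !big_nil setIT mule1 eqxx.
rewrite eq_sym (negbTE ij); apply=> //.
  by move=> l /=; rewrite !inE => /orP[]/eqP ->.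
by move=> l; case: ifP.
Qed.

End Independence.

(** * Conditional expectations identified by mean-square approximation *)

Section ConditionalExpectation.
Context d (T : measurableType d) (R : realType) (P : probability T R).
Implicit Types (X Y Z : T -> R) (F : set (set T)).

Notation L2 := (Lfun P 2%:E).

(** The [L^1] contraction of conditional expectation: [{U > 0}] and its complement belong to the
    sub-sigma-algebra and [U] has a fixed sign on each, so there the integral of [|U|] is plus or
    minus that of [V]. *)
Lemma integral_abs_le F U V :
  <<s F>> `<=` measurable ->
  (forall B, measurable B -> <<s F>> (U @^-1` B)) ->
  P.-integrable setT (EFin \o U) -> P.-integrable setT (EFin \o V) ->
  (forall A, <<s F>> A ->
    \int[P]_(w in A) (U w)%:E = \int[P]_(w in A) (V w)%:E)%E ->
  (\int[P]_w `|U w|%:E <= \int[P]_w `|V w|%:E)%E.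
Proof.
move=> FT mU iU iV UV.
pose E := U @^-1` `]0, +oo[.
have FE : <<s F>> E by exact: mU.
have FCE : <<s F>> (~` E).
  by rewrite /E preimage_setC; apply: mU; exact: measurableC.
have mE := FT _ FE; have mCE := FT _ FCE.
have split_int X : P.-integrable setT (EFin \o X) ->
    (\int[P]_w `|X w|%:E =
      \int[P]_(w in E) `|X w|%:E + \int[P]_(w in ~` E) `|X w|%:E)%E.
  move=> iX; rewrite -ge0_integral_setU ?setUv//.
  - have /integrableP[mX _] := iX.
    apply/measurable_EFinP; apply: measurableT_comp => //.
    exact/measurable_EFinP.
  - by apply/disj_setPCl.
rewrite !split_int//; apply: leeD.
- rewrite (_ : (\int[P]_(w in E) `|U w|%:E = \int[P]_(w in E) (U w)%:E)%E).
    rewrite UV//; apply: le_integral => //.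
    + exact: integrableS iV.
    + exact: (integrableS measurableT mE (@subsetT _ _) (integrable_abse iV)).
    + by move=> w _; rewrite lee_fin ler_norm.
  apply: eq_integral => w; rewrite inE /E /= in_itv/= andbT => U0.
  by rewrite ger0_norm// ltW.
- rewrite (_ : (\int[P]_(w in ~` E) `|U w|%:E =
      - \int[P]_(w in ~` E) (U w)%:E)%E).
    rewrite UV// -integralN; last first.
      apply: integrable_add_def => //.
      exact: (integrableS measurableT mCE (@subsetT _ _) iV).
    apply: le_integral => //.
    + apply: integrableN; exact: integrableS iV.
    + exact: (integrableS measurableT mCE (@subsetT _ _) (integrable_abse iV)).
    + by move=> w _; rewrite -EFinN lee_fin -normrN ler_norm.
  rewrite -integralN; last first.
    apply: integrable_add_def => //.
    exact: (integrableS measurableT mCE (@subsetT _ _) iU).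
  apply: eq_integral => w; rewrite inE /E /= in_itv/= andbT => /negP U0.
  by rewrite ler0_norm ?EFinN// leNgt.
Qed.

(* AM-GM: [|z| <= c + z^2 / c] *)
Lemma integral_abs_dot (c : R) Z : 0 < c -> Z \in L2 ->
  (\int[P]_w `|Z w|%:E <= (c + c^-1 * dot P Z Z)%:E)%E.
Proof.
move=> c0 lZ.
have lZZ : (fun w => c^-1 * (Z \* Z) w) \in Lfun P 1.
  rewrite (_ : (fun w => _) = c^-1 \o* (Z \* Z)).
    by apply: Lfun_scale => //; exact: Lfun2_mul_Lfun1.
  by apply/funext => w /=; rewrite mulrC.
have -> : ((c + c^-1 * dot P Z Z)%:E =
    'E_P[(cst c \+ (fun w => c^-1 * (Z \* Z) w))%R])%E.
  rewrite expectationD ?Lfun_cst// expectation_cst EFinD EFinM -dotE//.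
  rewrite -expectationZl ?Lfun2_mul_Lfun1//.
  by congr (_ + 'E_P[_])%E; apply/funext => w /=; rewrite mulrC.
have mZ := Lfun2_mfun lZ.
rewrite unlock; apply: ge0_le_integral => //.
- by apply/measurable_EFinP; exact: measurableT_comp.
- apply/measurable_EFinP; apply: measurable_funD => //.
  by apply: measurable_funM => //; apply: measurable_funM.
- move=> w _; rewrite lee_fin /= -subr_ge0.
  have -> : c + c^-1 * (Z w * Z w) - `|Z w| =
     c^-1 * ((`|Z w| - c / 2) ^+ 2 + 3 / 4 * c ^+ 2).
    rewrite -[Z w * Z w]expr2 -[Z w ^+ 2]real_normK ?num_real//.
    by field; rewrite gt_eqF.
  rewrite mulr_ge0 ?invr_ge0 ?(ltW c0)// addr_ge0 ?sqr_ge0//.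
  by rewrite mulr_ge0 ?sqr_ge0.
Qed.

(** A mean-square limit is measurable for the sub-sigma-algebra only up to null sets, so [Y] is
    compared with the measurable [S N] instead. Contraction gives [||Y - S N||_1 <= ||A - S N||_1],
    hence [||Y - A||_1 <= 2 ||S N - A||_1]. *)
Lemma cond_exp_ms_limit F X Y A (S : nat -> T -> R) :
  <<s F>> `<=` measurable -> is_cond_exp P <<s F>> X Y ->
  (forall N, S N \in L2) ->
  (forall N, measurable_fun [set: g_sigma_algebraType F] (S N)) ->
  ms_cvg P S A ->
  (forall E, <<s F>> E ->
    \int[P]_(w in E) (X w)%:E = \int[P]_(w in E) (A w)%:E)%E ->
  {ae P, forall w, Y w = A w}.
Proof.
move=> FT [mY iY YX] lS mS /(ms_cvgE _ lS)[lA cA] XA.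
have iA := Lfun2_integrable lA.
have mY' : measurable_fun [set: g_sigma_algebraType F] Y.
  by move=> _ B mB; rewrite setTI; exact: mY.
have bound N : (\int[P]_w `|Y w - S N w|%:E <= \int[P]_w `|S N w - A w|%:E)%E.
  have iS := Lfun2_integrable (lS N).
  have -> : (\int[P]_w `|S N w - A w|%:E = \int[P]_w `|A w - S N w|%:E)%E.
    by apply: eq_integral => w _; rewrite distrC.
  apply: (@integral_abs_le F (Y \- S N) (A \- S N)) => //.
  - move=> B mB.
    have /(_ measurableT B mB) := measurable_funB mY' (mS N).
    by rewrite setTI.
  - exact: (integrableB measurableT iY iS).
  - exact: (integrableB measurableT iA iS).
  - move=> E FE; have mE := FT _ FE.
    rewrite /=; under eq_integral do rewrite EFinB.
    under [in RHS]eq_integral do rewrite EFinB.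
    rewrite !integralB//=; do ?exact: (integrableS measurableT).
    by rewrite YX// XA.
have YA0 : (\int[P]_w `|(Y w - A w)%:E| = 0)%E.
  apply/eqP; rewrite eq_le integral_ge0// andbT.
  apply/lee_addgt0Pr => e e0; rewrite add0e.
  (* A squared distance of at most [c^2] gives an [L^1] distance of at most [2 c] by
     [integral_abs_dot]; the triangle inequality uses it twice. *)
  pose c := e / 4.
  have c0 : 0 < c by rewrite divr_gt0.
  have [N cN] : exists N, dot P (S N \- A) (S N \- A) <= c ^+ 2.
    have /cvgrPdist_le/(_ (c ^+ 2)) := cA.
    rewrite exprn_gt0// => /(_ isT)[N _ /(_ N (leqnn N))] /=.
    by rewrite sub0r normrN => h; exists N; apply: le_trans h; exact: ler_norm.
  have lSA : S N \- A \in L2 by exact: Lfun2B.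
  have := integral_abs_dot c0 lSA.
  have : (c + c^-1 * dot P (S N \- A) (S N \- A) <= c + c).
    by rewrite lerD2l mulrC ler_pdivrMr// -expr2.
  rewrite -lee_fin => h1 /le_trans /(_ h1) {h1} h.
  have -> : e = (c + c) + (c + c) by rewrite /c; field.
  rewrite EFinD; apply: le_trans (leeD (le_trans (bound N) h) h).
  have mYT : measurable_fun setT Y.
    by have /integrableP[/measurable_EFinP] := iY.
  have mST := Lfun2_mfun (lS N); have mAT := Lfun2_mfun lA.
  rewrite -ge0_integralD//; last 2 first.
  - apply/measurable_EFinP; apply: measurableT_comp => //.
    exact: measurable_funB.
  - apply/measurable_EFinP; apply: measurableT_comp => //.
    exact: measurable_funB.
  apply: ge0_le_integral => //.
  - apply: measurableT_comp => //; apply/measurable_EFinP.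
    exact: measurable_funB.
  - apply: emeasurable_funD; apply/measurable_EFinP;
      apply: measurableT_comp => //; exact: measurable_funB.
  - move=> w _; rewrite abse_EFin -EFinD lee_fin /=.
    by rewrite -[Y w - A w](subrKA (S N w)) ler_normD.
have /ae_eq_integral_abs : measurable_fun setT (fun w => (Y w - A w)%:E).
  apply/measurable_EFinP; apply: measurable_funB; last exact: (Lfun2_mfun lA).
  by have /integrableP[/measurable_EFinP] := iY.
move=> /(_ P measurableT)[/(_ YA0) + _].
apply: filterS => w /(_ I) [] /eqP; rewrite subr_eq0 => /eqP.
by [].
Qed.

End ConditionalExpectation.

(** * Decision variance as a mean square *)

Section DecisionVariance.
Context d (T : measurableType d) (R : realType) (P : probability T R).
Implicit Types (X Y Z : T -> R) (F : set (set T)).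

Notation L2 := (Lfun P 2%:E).

Lemma Lfun2_indic (E : set T) : measurable E -> (\1_E : T -> R) \in L2.
Proof.
move=> mE; rewrite inE; apply/andP; split; rewrite inE /=.
  exact: measurable_indic.
rewrite /finite_norm unlock /Lnorm poweR_lty//.
rewrite (eq_integral (fun w => (\1_E w)%:E)) => [|w _].
  by rewrite integral_indic// ltey_eq fin_num_measure//; exact: measurableI.
rewrite /= indicE.
by case: (_ \in _); rewrite ?normr1 ?normr0 ?powR1// powR0.
Qed.

Lemma dot_indic E X : measurable E -> X \in L2 ->
  (\int[P]_(w in E) (X w)%:E = (dot P \1_E X)%:E)%E.
Proof.
move=> mE lX; rewrite -dotE ?Lfun2_indic// unlock integral_mkcond.
by apply: eq_integral => w _; rewrite epatch_indic /= mulrC.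
Qed.

Lemma dot_sum0 (I : eqType) (s : seq I) (a : I -> R) (X : I -> T -> R) Y :
  Y \in L2 -> (forall i, X i \in L2) -> {in s, forall i, dot P Y (X i) = 0} ->
  dot P Y (fun w => \sum_(i <- s) a i * X i w) = 0.
Proof.
move=> lY lX; elim: s => [_|i s IHs h].
  rewrite /dot (_ : _ \* _ = cst 0) ?expectation_cst//.
  by apply/funext => w /=; rewrite big_nil mulr0.
rewrite (_ : (fun w => _) = (fun w => a i * X i w) \+
    (fun w => \sum_(i <- s) a i * X i w)); last first.
  by apply/funext => w; rewrite big_cons.
rewrite dotDr ?Lfun2Z//; last by apply: Lfun2_sum => j; exact: Lfun2Z.
rewrite dotZr// h ?mem_head// mulr0 add0r IHs// => j js.
by rewrite h// inE js orbT.
Qed.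

(** [W] integrates to 0 over every event of the sub-sigma-algebra, so the conditional expectation of
    [X] is [A] almost surely and the residual is [W]. *)
Lemma expectation_cond_var F X A W (S : nat -> T -> R) :
  <<s F>> `<=` measurable -> X \in L2 ->
  (forall N, S N \in L2) ->
  (forall N, measurable_fun [set: g_sigma_algebraType F] (S N)) ->
  ms_cvg P S A -> W \in L2 ->
  (forall E, <<s F>> E -> dot P \1_E W = 0) ->
  {ae P, forall w, X w = A w + W w} ->
  ('E_P[cond_var P <<s F>> X] = (dot P W W)%:E)%E.
Proof.
move=> FT lX lS mS cSA lW EW XAW.
have [lA _] := cSA.
have mX := Lfun2_mfun lX; have mA := Lfun2_mfun lA; have mW := Lfun2_mfun lW.
have cY := cond_expP FT (Lfun2_integrable lX).
have YA : {ae P, forall w, cond_exp P <<s F>> X w = A w}.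
  apply: (cond_exp_ms_limit FT cY lS mS cSA) => E FE.
  have mE := FT _ FE.
  rewrite (@ae_eq_integral _ _ _ P E (fun w => (A w + W w)%:E))//.
  - under eq_integral do rewrite EFinD.
    rewrite integralD//=; last 2 first.
      exact: (integrableS measurableT mE (@subsetT _ _) (Lfun2_integrable lA)).
      exact: (integrableS measurableT mE (@subsetT _ _) (Lfun2_integrable lW)).
    by rewrite (dot_indic mE lW) EW// adde0.
  - by apply/measurable_EFinP; exact: measurable_funTS.
  - by apply/measurable_EFinP/measurable_funTS; exact: measurable_funD.
  - by apply: filterS XAW => w -> _.
set Y := cond_exp P <<s F>> X in YA *.
pose V w := (X w - Y w) ^+ 2.
have mY : measurable_fun setT Y.
  by have [_ /integrableP[/measurable_EFinP]] := cY.
have mV : measurable_fun setT V.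
  by apply: measurable_funX; exact: measurable_funB.
have VW : ae_eq P setT (EFin \o V) (EFin \o (W \* W)).
  apply: filterS2 XAW YA => w xw yw _ /=.
  by rewrite /V xw yw addrAC subrr add0r expr2.
have iW : P.-integrable setT (EFin \o (W \* W)).
  by apply/Lfun1_integrable; exact: Lfun2_mul_Lfun1.
have mW2 : measurable_fun setT (EFin \o (W \* W)) by have /integrableP[] := iW.
have iV : P.-integrable setT (EFin \o V).
  apply/integrableP; split; first exact/measurable_EFinP.
  have /integrableP[_] := iW; apply: le_lt_trans.
  rewrite (@ae_eq_integral _ _ _ P setT (fun w => `|(W w * W w)%:E|%E))//.
  - by apply: measurableT_comp => //; exact/measurable_EFinP.
  - exact: measurableT_comp.
  - by apply: filterS VW => w /(_ I) VWw _; exact: (congr1 abse VWw).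
(* Taking the whole space as the event removes the conditioning under the outer expectation. *)
have [_ _ /(_ setT)] := cond_expP FT iV.
rewrite -/(cond_var P <<s F>> X) => intV.
rewrite unlock intV; last first.
  exact: (@measurableT _ (g_sigma_algebraType F)).
rewrite -dotE// unlock; apply: ae_eq_integral => //.
exact/measurable_EFinP.
Qed.

Lemma sigma_process_preimage (I : Type) (J : set I) (X : I -> T -> R) i B :
  J i -> measurable B -> sigma_process J X (X i @^-1` B).
Proof.
move=> Ji mB; apply: sub_sigma_algebra; exists i => //.
by exists B => //; rewrite setTI.
Qed.

Lemma sigma_indic_preimage F (E : set T) (B : set R) : <<s F>> E ->
  <<s F>> ((\1_E : T -> R) @^-1` B).
Proof.
move=> FE; have FT : <<s F>> setT.
  exact: (@measurableT _ (g_sigma_algebraType F)).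
rewrite preimage_indic; case: ifP => _; case: ifP => _ //.
  exact: (@measurableC _ (g_sigma_algebraType F)).
exact: sigma_algebra0.
Qed.

End DecisionVariance.

Lemma Gamma_gt1 (R : realType) (theta lambda : R) :
  0 < theta -> 0 < lambda -> lambda <= 1 -> 1 < Gamma theta lambda.
Proof.
move=> t0 l0 l1; have tl : 0 < theta * lambda by rewrite mulr_gt0.
rewrite /Gamma -addrA ltrDl addr_gt0//; first by rewrite -mulrA mulr_gt0.
by rewrite divr_gt0 ?mulr_gt0 ?exprn_gt0//; lra.
Qed.

(** * Assembly: orthogonal expansion of the shock series *)

Theorem mainTheorem2 (R : realType) (d : measure_display)
  (T : measurableType d) (P : probability T R) (n : nat)
  (theta_ lambda_ sigma_ : nat -> R) (theta lambda sigmaD : R)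
  (D : int -> T -> R) (q IP qhat eps : nat -> int -> T -> R)
  (theta_gt0 : 0 < theta) (lambda_gt0 : 0 < lambda) (lambda_le1 : lambda <= 1)
  (theta_ge : forall k, (1 <= k <= n)%N -> theta <= theta_ k)
  (lambda_itv : forall k, (1 <= k <= n)%N -> lambda <= lambda_ k <= 1)
  (D_L2 : forall t, D t \in Lfun P 2%:E)
  (tier_L2 : forall k t, (1 <= k <= n)%N ->
    [/\ q k t \in Lfun P 2%:E, IP k t \in Lfun P 2%:E,
        qhat k t \in Lfun P 2%:E & eps k t \in Lfun P 2%:E])
  (chain : linear_benchmark P n theta_ lambda_ D q IP qhat eps)
  (stationary : stationary_orders P n theta_ lambda_ D q eps)
  (D_mean : forall t, 'E_P[D t]%E = 0%E)
  (D_indep : mutually_independent P setT D)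
  (sigmaD_gt0 : 0 < sigmaD ^+ 2)
  (D_var : forall t, ((sigmaD ^+ 2)%:E <= 'V_P[D t])%E)
  (eps_mean : forall k t, (1 <= k <= n)%N -> 'E_P[eps k t]%E = 0%E)
  (eps_indep : mutually_independent P [set i : nat * int | (1 <= i.1 <= n)%N]
    (fun i => eps i.1 i.2))
  (eps_D_indep : independent_sigma P
    (sigma_process [set i : nat * int | (1 <= i.1 <= n)%N]
      (fun i => eps i.1 i.2))
    (sigma_process setT D))
  (sigma_gt0 : forall k, (1 <= k <= n)%N -> 0 < sigma_ k ^+ 2)
  (eps_var : forall k t, (1 <= k <= n)%N ->
    ((sigma_ k ^+ 2)%:E <= 'V_P[eps k t])%E) :
  1 < Gamma theta lambda /\
  forall k t, (1 <= k <= n)%N ->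
    ((2 * \sum_(1 <= j < k.+1) sigma_ j ^+ 2 * Gamma theta lambda ^+ (k - j))%:E
      <= decision_variance P D (q k t))%E.
Proof.
split; first exact: Gamma_gt1.
move=> k t kn; have /andP[k1 k_n] := kn.
have [A [B [cA cB qE]]] := stationary k t kn.
have [lq _ _ _] := tier_L2 k t kn.
pose F : set (set T) :=
  \bigcup_(i in [set: int]) preimage_set_system setT (D i) measurable.
have FT : <<s F>> `<=` measurable.
  by apply: sigma_process_measurable => i _; exact: (Lfun2_mfun (D_L2 i)).
(* Shocks are set to 0 outside the tiers [1..n], so that square-integrability holds at every
   index. *)
pose e (p : nat * int) : T -> R :=
  if (1 <= p.1 <= n)%N then eps p.1 p.2 else cst 0.
have lE p : e p \in Lfun P 2%:E.
  rewrite /e; case: ifP => [h|_]; last exact: Lfun_cst.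
  by have [] := tier_L2 p.1 p.2 h.
have jn j : j \in index_iota 1 k.+1 -> (1 <= j <= n)%N.
  by rewrite mem_index_iota ltnS => /andP[-> /leq_trans]; apply.
pose a j := HG_coef theta_ lambda_ j k.
pose SB j N w := \sum_(i < N) a j i * e (j, t - i%:Z) w.
have lSB j N : SB j N \in Lfun P 2%:E by apply: Lfun2_sum => i; exact: Lfun2Z.
pose W w := \sum_(1 <= j < k.+1) B j w.
pose WN N w := \sum_(1 <= j < k.+1) SB j N w.
have lWN N : WN N \in Lfun P 2%:E by exact: Lfun2_sum.
have cW : ms_cvg P WN W.
  apply: ms_cvg_sum => // j js; have := cB j.
  rewrite mem_index_iota ltnS in js; move=> /(_ js).
  rewrite /filter_at /SB /e /=.
  by rewrite jn// mem_index_iota ltnS.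
(* The double sum over tiers and delays is flattened into one sum over pairs, whose terms are
   pairwise orthogonal. *)
pose idx N : seq (nat * nat) :=
  allpairs pair (index_iota 1 k.+1) (index_iota 0 N).
pose ep (p : nat * nat) := e (p.1, t - p.2%:Z).
have lep p : ep p \in Lfun P 2%:E by exact: lE.
have idx_uniq N : uniq (idx N).
  by apply: allpairs_uniq; rewrite ?iota_uniq// => -[? ?] [? ?].
have WNE N : WN N = fun w => \sum_(p <- idx N) a p.1 p.2 * ep p w.
  apply/funext => w; rewrite big_allpairs; apply: eq_bigr => j _.
  by rewrite big_mkord.
have idx_n N p : p \in idx N -> (1 <= p.1 <= n)%N.
  by move=> /allpairsP[[i j] /= [/jn + _ ->]].
have ep0 N p : p \in idx N -> ('E_P[ep p] = 0)%E.
  by move=> /idx_n h; rewrite /ep /e /= h eps_mean.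
(* A centred shock is orthogonal to any square-integrable variable independent of it: indicators of
   demand events in [orthW], the other shocks in the final expansion. *)
have dot0 X N p : p \in idx N -> X \in Lfun P 2%:E ->
    (forall C B, measurable C -> measurable B ->
      P (X @^-1` C `&` ep p @^-1` B) = P (X @^-1` C) * P (ep p @^-1` B))%E ->
    dot P X (ep p) = 0.
  move=> pN lX ind; apply: EFin_inj; rewrite -dotE//.
  by rewrite independent_expectationM// (ep0 N)// mule0.
have orthW E : <<s F>> E -> dot P \1_E W = 0.
  move=> FE; have lE1 := Lfun2_indic P (FT _ FE).
  apply: (ms_cvg_orth lWN cW lE1) => N; rewrite WNE.
  apply: dot_sum0 => // p pN; apply: (dot0 _ N) => // C B' mC mB.
  rewrite setIC muleC; apply: eps_D_indep.
    rewrite /ep /e /= (idx_n N)//.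
    exact: (@sigma_process_preimage _ _ _ _ _ (fun i : nat * int => eps i.1 i.2)
      (p.1, t - p.2%:Z) _ (idx_n _ _ pN) mB).
  exact: sigma_indic_preimage.
have lW : W \in Lfun P 2%:E by have [] := cW.
have -> : decision_variance P D (q k t) = (dot P W W)%:E.
  pose SA N w := \sum_(i < N) H_coef theta_ lambda_ 0 k i * D (t - i%:Z) w.
  apply: (@expectation_cond_var _ _ _ P F _ A W SA) => //.
  - by move=> N; apply: Lfun2_sum => i; exact: Lfun2Z.
  - move=> N; apply: measurable_sum => i; apply: measurable_funM => //.
    move=> _ C mC; rewrite setTI; exact: sigma_process_preimage.
rewrite lee_fin.
(* Lower bound for the mean square of the truncation [WN N], each shock variance being replaced by
   its bound [sigma_ j ^+ 2]. *)
pose v N := \sum_(1 <= j < k.+1) sigma_ j ^+ 2 * \sum_(i < N) a j i * a j i.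
have ha j : j \in index_iota 1 k.+1 -> high_pass (a j) /\
    2 * Gamma theta lambda ^+ (k - j) <= l2dot (a j) (a j).
  rewrite mem_index_iota ltnS => /andP[j1 jk].
  have hj i : (j < i <= k)%N -> theta <= theta_ i /\ lambda <= lambda_ i <= 1.
    move=> /andP[ji ik]; have : (1 <= i <= n)%N.
      by rewrite (leq_trans ik)// andbT (leq_trans j1)// ltnW.
    by move=> h; rewrite theta_ge// lambda_itv.
  split; last by apply: l2dot_HG_coef_ge => //; exact: ltW.
  apply: high_pass_HG_coef => // i /hj [ti /andP[li ->]].
  have l0 := lt_le_trans lambda_gt0 li.
  by rewrite l0 mulr_ge0// ?(ltW l0)// (le_trans (ltW theta_gt0)).
have cv : v @ \oo --> \sum_(1 <= j < k.+1) sigma_ j ^+ 2 * l2dot (a j) (a j).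
  rewrite /v big_seq; under eq_fun do rewrite big_seq.
  apply: cvg_big => [|j /ha[[la _] _]]; first exact: add_continuous.
  by apply: cvgMr; exact: cvg_l2dot.
apply: (@le_trans _ _ (\sum_(1 <= j < k.+1) sigma_ j ^+ 2 * l2dot (a j) (a j))).
  rewrite mulr_sumr big_seq [leRHS]big_seq; apply: ler_sum => j /ha[_ h].
  by rewrite mulrCA ler_wpM2l// sqr_ge0.
apply: (ms_cvg_ge lWN cW _ cv) => N.
rewrite WNE dot_sum_orth//; last first.
  move=> p p' pN p'N pp'; apply: (dot0 _ N) => // C B' mC mB.
  rewrite /ep /e /= !(idx_n N)//.
  apply: (mutually_independent_pair (i := (p.1, t - p.2%:Z))
    (j := (p'.1, t - p'.2%:Z)) eps_indep) => //=; rewrite ?(idx_n N)//.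
  (* Distinct pairs (tier, delay) give distinct pairs (tier, time), as [i] maps injectively to
     [t - i]. *)
  apply: contraNneq pp' => -[e1 /addrI/oppr_inj[] e2].
  by apply/eqP; case: p p' e1 e2 {pN p'N} => [? ?] [? ?] /= -> ->.
rewrite big_allpairs /v [leLHS]big_seq [leRHS]big_seq; apply: ler_sum => j js.
rewrite mulr_sumr big_mkord; apply: ler_sum => i _ /=.
rewrite -expr2 mulrC ler_wpM2l ?sqr_ge0//.
have jn' := jn j js; rewrite /ep /e /= jn' -lee_fin -dotE; last 2 first.
  by have [] := tier_L2 j (t - i%:Z) jn'.
  by have [] := tier_L2 j (t - i%:Z) jn'.
(* With mean zero the variance is the second moment. *)
have := eps_var j (t - i%:Z) jn'; rewrite varianceE; last first.
  by have [] := tier_L2 j (t - i%:Z) jn'.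
by rewrite eps_mean// expe2 mul0e sube0.
Qed.
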